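(* Assume the entropy variable map $\mathbf{u}\mapsto\mathbf{w}(\mathbf{u})$ is a $C^1$ diffeomorphism from $\mathcal{U}$ onto a convex set $\mathcal{W}$, with inverse $\mathbf{w}\mapsto\mathbf{u}(\mathbf{w})$, and that $\mathbf{A}$ and $\mathbf{H}$ are continuous. For $\mathbf{u}_L,\mathbf{u}_R\in\mathcal{U}$ let $\Phi(s):=\mathbf{w}_L+s[\![\mathbf{w}]\!]$, $s\in[0,1]$, be the linear path in entropy variables (corresponding to the path $s\mapsto\mathbf{u}(\Phi(s))$ in state space), and define $$\mathbf{D}^-(\mathbf{u}_L,\mathbf{u}_R)=\int_0^1(1-s)\,\mathbf{A}(\mathbf{u}(\Phi(s)))\,\mathbf{H}(\Phi(s))\,ds\;[\![\mathbf{w}]\!],\qquad \mathbf{D}^+(\mathbf{u}_L,\mathbf{u}_R)=\int_0^1 s\,\mathbf{A}(\mathbf{u}(\Phi(s)))\,\mathbf{H}(\Phi(s))\,ds\;[\![\mathbf{w}]\!].$$ Then $\mathbf{D}^\pm$ are entropy conservative fluctuations, i.e. they satisfy (C1)–(C5) with respect to the family of paths $\Phi(s;\mathbf{u}_L,\mathbf{u}_R)=\mathbf{u}(\mathbf{w}_L+s[\![\mathbf{w}]\!])$.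
   Context: System: $\mathbf{u}_t+\mathbf{f}(\mathbf{u})_x+\mathbf{B}(\mathbf{u})\mathbf{u}_x=0$, $\mathbf{u}\in\mathcal{U}\subset\mathbb{R}^n$, generalized Jacobian $\mathbf{A}:=\mathbf{f}_{\mathbf{u}}+\mathbf{B}$. Entropy pair: a strictly convex $C^2$ function $S$ and entropy flux $q$ with $q_{\mathbf{u}}=\mathbf{w}^T(\mathbf{f}_{\mathbf{u}}+\mathbf{B})$, where $\mathbf{w}(\mathbf{u}):=S_{\mathbf{u}}(\mathbf{u})$ are the entropy variables; $\mathbf{H}^{-1}(\mathbf{u}):=\mathbf{w}_{\mathbf{u}}=S_{\mathbf{u}\mathbf{u}}$ and $\mathbf{H}(\mathbf{w}):=\mathbf{u}_{\mathbf{w}}$ its inverse, viewed as a function of $\mathbf{w}$. Notation: $[\![\cdot]\!]=(\cdot)_R-(\cdot)_L$, $\mathbf{w}_L=\mathbf{w}(\mathbf{u}_L)$, $q_L=q(\mathbf{u}_L)$, etc. EC fluctuation conditions, for all $\mathbf{u},\mathbf{u}_L,\mathbf{u}_R$, with a given family of paths $\Phi(s;\mathbf{u}_L,\mathbf{u}_R)$: (C1) $\mathbf{D}^\pm(\mathbf{u},\mathbf{u})=0$; (C2) $\mathbf{D}^-(\mathbf{u}_L,\mathbf{u}_R)+\mathbf{D}^+(\mathbf{u}_L,\mathbf{u}_R)=\int_0^1\mathbf{A}(\Phi(s;\mathbf{u}_L,\mathbf{u}_R))\partial_s\Phi(s;\mathbf{u}_L,\mathbf{u}_R)\,ds$; (C3)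 $\mathbf{D}^-(\mathbf{u}_L,\mathbf{u}_R)+\mathbf{D}^+(\mathbf{u}_R,\mathbf{u}_L)=0$; (C4) $\mathbf{w}_L^T\mathbf{D}^-(\mathbf{u}_L,\mathbf{u}_R)+\mathbf{w}_R^T\mathbf{D}^+(\mathbf{u}_L,\mathbf{u}_R)=q_R-q_L$; (C5) $\frac{\partial\mathbf{D}^-(\mathbf{u}_L,\mathbf{u}_R)}{\partial\mathbf{u}_R}\big|_{\mathbf{u}_R=\mathbf{u}_L}=\frac12\mathbf{A}(\mathbf{u}_L)$. *)

(* Defs.v *)
From mathcomp Require Import all_boot all_order all_algebra.
From mathcomp Require Import all_classical all_reals all_analysis.
Set Implicit Arguments. Unset Strict Implicit. Unset Printing Implicit Defensive.
Import Order.TTheory GRing.Theory Num.Theory numFieldNormedType.Exports.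
Local Open Scope classical_set_scope.
Local Open Scope ring_scope.

Definition grad (R : realType) (n : nat) (S : 'cV[R]_n -> R) (u : 'cV[R]_n) : 'cV[R]_n :=
  \col_i ('d S u (delta_mx i 0)).

Definition jac (R : realType) (m n : nat) (F : 'cV[R]_n -> 'cV[R]_m) (u : 'cV[R]_n)
  : 'M[R]_(m, n) :=
  \matrix_(i, j) ('d F u (delta_mx j 0) i 0).

Definition mint (R : realType) (m k : nat) (F : R -> 'M[R]_(m, k)) : 'M[R]_(m, k) :=
  \matrix_(i, j) Rintegral (@lebesgue_measure R) `[0%R, 1%R] (fun s => F s i j).

Definition dotc (R : realType) (n : nat) (x y : 'cV[R]_n) : R := (x^T *m y) 0 0.

Definition convex_setR (R : realType) (n : nat) (W : set 'cV[R]_n) : Prop :=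
  forall x y t, W x -> W y -> 0 <= t <= 1 -> W ((1 - t) *: x + t *: y).

Definition strictly_convex_on (R : realType) (n : nat) (U : set 'cV[R]_n)
  (S : 'cV[R]_n -> R) : Prop :=
  forall x y t, (forall s, 0 <= s <= 1 -> U ((1 - s) *: x + s *: y)) ->
    x != y -> 0 < t < 1 ->
    S ((1 - t) *: x + t *: y) < (1 - t) * S x + t * S y.

Definition C1_on (R : realType) (m n : nat) (D : set 'cV[R]_n)
  (F : 'cV[R]_n -> 'cV[R]_m) : Prop :=
  (forall u, D u -> differentiable F u) /\
  (forall u, D u -> {for u, continuous (jac F)}).

Definition C2_on (R : realType) (n : nat) (U : set 'cV[R]_n) (S : 'cV[R]_n -> R) : Prop :=
  (forall u, U u -> differentiable S u) /\ C1_on U (grad S).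

Definition genA (R : realType) (n : nat) (f : 'cV[R]_n -> 'cV[R]_n)
  (B : 'cV[R]_n -> 'M[R]_n) (u : 'cV[R]_n) : 'M[R]_n :=
  jac f u + B u.

(* the fluctuations D^-, D^+ built on the linear path in entropy variables;
   w = entropy variables, ui = inverse map w |-> u(w), H = jac ui *)
Definition Dminus (R : realType) (n : nat) (A : 'cV[R]_n -> 'M[R]_n)
  (w ui : 'cV[R]_n -> 'cV[R]_n) (uL uR : 'cV[R]_n) : 'cV[R]_n :=
  mint (fun s => (1 - s) *: (A (ui (w uL + s *: (w uR - w uL)))
                              *m jac ui (w uL + s *: (w uR - w uL))))
    *m (w uR - w uL).

Definition Dplus (R : realType) (n : nat) (A : 'cV[R]_n -> 'M[R]_n)
  (w ui : 'cV[R]_n -> 'cV[R]_n) (uL uR : 'cV[R]_n) : 'cV[R]_n :=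
  mint (fun s => s *: (A (ui (w uL + s *: (w uR - w uL)))
                        *m jac ui (w uL + s *: (w uR - w uL))))
    *m (w uR - w uL).

Definition EC_fluctuations (R : realType) (n : nat) (U : set 'cV[R]_n)
  (A : 'cV[R]_n -> 'M[R]_n) (w : 'cV[R]_n -> 'cV[R]_n) (q : 'cV[R]_n -> R)
  (Phi : 'cV[R]_n -> 'cV[R]_n -> R -> 'cV[R]_n)
  (Dm Dp : 'cV[R]_n -> 'cV[R]_n -> 'cV[R]_n) : Prop :=
  [/\ (* C1 *) (forall u, U u -> Dm u u = 0 /\ Dp u u = 0),
      (* C2 *) (forall uL uR, U uL -> U uR ->
                 Dm uL uR + Dp uL uR
                 = mint (fun s => A (Phi uL uR s) *m derive1 (Phi uL uR) s)),
      (* C3 *) (forall uL uR, U uL -> U uR -> Dm uL uR + Dp uR uL = 0),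
      (* C4 *) (forall uL uR, U uL -> U uR ->
                 dotc (w uL) (Dm uL uR) + dotc (w uR) (Dp uL uR) = q uR - q uL) &
      (* C5 *) (forall uL, U uL ->
                 differentiable (Dm uL) uL /\ jac (Dm uL) uL = 2^-1 *: A uL)].

(* Main.v *)
(** Along the segment [w_L + s [[w]]] the derivative of [q o u] is
    [Phi(s)^T A H [[w]]], because [q_u = w^T A] and [w(u(Phi)) = Phi]; weighting
    by [1 - s] and [s] recombines [w_L] and [w_R] into [Phi(s)], so (C4) is the
    fundamental theorem of calculus.  (C2) is the chain rule and (C3) the
    substitution [s -> 1 - s].  For (C5), [D^-(u_L, u) = M(u) (w(u) - w_L)] has
    a second factor vanishing at [u_L], so continuity of [M] at [u_L] is enough
    for differentiability there, with derivative
    [M(u_L) w_u = (1/2) A H w_u = (1/2) A]. *)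
From HB Require Import structures.
Require Import Defs.
From mathcomp Require Import all_boot all_order all_algebra.
From mathcomp Require Import all_classical all_reals all_analysis.
From mathcomp Require Import ring lra.
Import Order.TTheory GRing.Theory Num.Theory numFieldNormedType.Exports.
Local Open Scope classical_set_scope.
Local Open Scope ring_scope.

Set Implicit Arguments.
Unset Strict Implicit.

(** * Norms and limits of matrices through their entries *)

Lemma ler_mx_norm_coord (R : realType) (m n : nat) (M : 'M[R]_(m, n)) i j :
  `|M i j| <= `|M|.
Proof.
rewrite [leRHS]/Num.Def.normr/= mx_normrE.
exact: (le_bigmax _ (fun ij : 'I_m * 'I_n => `|M ij.1 ij.2|) (i, j)).
Qed.

Lemma mx_norm_le (R : realType) (m n : nat) (M : 'M[R]_(m, n)) (c : R) :
  0 <= c -> (forall i j, `|M i j| <= c) -> `|M| <= c.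
Proof.
move=> c0 Mc; rewrite [leLHS]/Num.Def.normr/= mx_normrE.
by rewrite (bigmax_le _ c0)//= => -[i j] _ /=; exact: Mc.
Qed.

(** The norm is the largest absolute value of an entry and each entry of the product is a sum of [n]
    terms, hence the factor [n%:R]. *)
Lemma ler_mx_norm_mulmx (R : realType) (m n p : nat) (M : 'M[R]_(m, n))
  (N : 'M[R]_(n, p)) : `|M *m N| <= n%:R * (`|M| * `|N|).
Proof.
apply: mx_norm_le => [|i j]; first by rewrite !mulr_ge0.
rewrite mxE (le_trans (ler_norm_sum _ _ _))// mulr_natl.
rewrite -[X in _ *+ X]card_ord -sumr_const.
by apply: ler_sum => k _; rewrite normrM ler_pM// ler_mx_norm_coord.
Qed.

(** There are finitely many entries, so the neighbourhoods on which each is [e]-close can be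
    intersected. *)
Lemma cvg_mx_coord (R : realType) (T : Type) (G : set_system T) {FG : Filter G}
  (m n : nat) (F : T -> 'M[R]_(m, n)) (M : 'M[R]_(m, n)) :
  (forall i j, F t i j @[t --> G] --> M i j) -> F @ G --> M.
Proof.
move=> FM; apply/cvgrPdist_le => /= e e0.
have : \forall t \near G, forall ij : 'I_m * 'I_n,
    `|M ij.1 ij.2 - F t ij.1 ij.2| <= e.
  by apply: filter_forall => -[i j]; exact: ((cvgrPdist_le _ _).1 (FM i j)).
apply: filterS => t tP; apply: mx_norm_le => [|i j]; first exact: ltW.
by rewrite !mxE; exact: (tP (i, j)).
Qed.

Lemma cvg_mulmx (R : realType) (T : Type) (G : set_system T) {FG : Filter G}
  (m n p : nat) (F : T -> 'M[R]_(m, n)) (K : T -> 'M[R]_(n, p))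
  (M : 'M[R]_(m, n)) (N : 'M[R]_(n, p)) :
  F @ G --> M -> K @ G --> N -> (F t *m K t) @[t --> G] --> M *m N.
Proof.
move=> FM KN; apply: cvg_mx_coord => i j.
rewrite mxE; under eq_fun do rewrite mxE.
apply: (@cvg_big _ _ +%R) => [|k _]; first by move=> y; exact: add_continuous.
apply: cvgM.
  exact: (cvg_comp _ _ FM (@coord_continuous _ _ _ i k M)).
exact: (cvg_comp _ _ KN (@coord_continuous _ _ _ k j N)).
Qed.

(** * Differentiating a matrix product whose second factor vanishes *)

(** The estimate says that the remainder is o(h), and a continuous linear map with such a remainder
    is the differential by uniqueness. *)
Lemma is_diff_near_le (R : realType) (V W : normedModType R) (f : V -> W)
  (df : {linear V -> W}) (x : V) : continuous df ->
  (forall e : R, 0 < e ->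
    \forall h \near 0, `|f (h + x) - (f x + df h)| <= e * `|h|) ->
  is_diff x f df.
Proof.
move=> cdf H.
have E : f \o shift x = cst (f x) + df +o_ 0 id.
  by apply/eqaddoP => e e0; apply: H.
have D := diff_unique cdf E.
by apply: DiffDef => //; apply/diff_locallyP; split; rewrite D.
Qed.

(** In the product rule the derivative of [M] would be multiplied by [g x = 0]; continuity of [M] at
    [x] replaces it. This is the analytic core of (C5). *)
Lemma is_diff_mulmx0 (R : realType) (V : normedModType R) (m n p : nat)
  (M : V -> 'M[R]_(m, n)) (g : V -> 'M[R]_(n, p)) (x : V) :
  {for x, continuous M} -> differentiable g x -> g x = 0 ->
  is_diff x (fun y => M y *m g y) (fun h => M x *m 'd g x h).
Proof.
move=> cM dg gx0.
have lin : linear (fun h => M x *m 'd g x h).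
  by move=> a u v; rewrite linearP/= mulmxDr scalemxAr.
pose dM := GRing.isLinear.Build _ _ _ _ _ lin.
pose dF : {linear _ -> _} := HB.pack (fun h => M x *m 'd g x h) dM.
have cdF : continuous dF.
  move=> h; apply: cvg_mulmx; first exact: cvg_cst.
  exact: (@diff_continuous _ _ _ _ _ dg).
apply: (@is_diff_near_le _ _ _ _ dF) => // e e0.
have [k k0 dgk] := linear_lipschitz (diff_continuous dg).
(* One tolerance for both the remainder of [g] and the variation of [M]. The bound [d <= 1] gives
   [|g (h + x)| <= (k + 1) |h|]; the quotient makes the total error at most [e |h|]. The final [+ 1]
   keeps the denominator positive even when [n] is 0. *)
pose d := Num.min 1 (e / (n%:R * (k + 1 + `|M x|) + 1)).
have c0 : 0 < n%:R * (k + 1 + `|M x|) + 1.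
  by rewrite ltr_wpDl// mulr_ge0// !addr_ge0// ltW.
have d0 : 0 < d by rewrite lt_min ltr01/= divr_gt0.
have d1 : d <= 1 by rewrite ge_min lexx.
have dc : n%:R * (d * (k + 1) + `|M x| * d) <= e.
  have : d * (n%:R * (k + 1 + `|M x|) + 1) <= e.
    by rewrite -ler_pdivlMr// ge_min lexx orbT.
  by apply: le_trans; lra.
have oz := (diff_locally dg); move/eqaddoP in oz.
have nearM : \forall h \near 0, `|M x - M (h + x)| <= d.
  have : M (h + x) @[h --> 0] --> M x.
    by move: cM; rewrite continuous_shift/= forE /continuous_at/= add0r.
  by move/cvgrPdist_le => /(_ d d0).
near=> h.
rewrite gx0 mulmx0 add0r /=.
have gh : `|g (h + x) - 'd g x h| <= d * `|h|.
  rewrite -[g (h + x)]subr0 -gx0 -addrA -opprD.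
  by near: h; exact: oz.
have Mh : `|M x - M (h + x)| <= d by near: h.
have gn : `|g (h + x)| <= (k + 1) * `|h|.
  rewrite -[g (h + x)](subrK ('d g x h)) (le_trans (ler_normD _ _))//.
  by rewrite addrC mulrDl lerD// (le_trans gh)// ler_wpM2r.
(* The first term is small because [M] varies little and [g (h + x)] is O(h), the second because
   [g (h + x) - 'd g x h] is o(h). *)
have -> : M (h + x) *m g (h + x) - M x *m 'd g x h =
  - ((M x - M (h + x)) *m g (h + x)) + M x *m (g (h + x) - 'd g x h).
  by rewrite mulmxBl mulmxBr opprB addrA subrK.
rewrite (le_trans (ler_normD _ _))// normrN.
apply: (@le_trans _ _ (n%:R * (d * (k + 1) + `|M x| * d) * `|h|)); last first.
  by rewrite ler_wpM2r.
rewrite -mulrA mulrDl mulrDr; apply: lerD.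
  rewrite (le_trans (ler_mx_norm_mulmx _ _))// ler_wpM2l// -mulrA.
  by rewrite ler_pM.
rewrite (le_trans (ler_mx_norm_mulmx _ _))// ler_wpM2l// -mulrA.
by rewrite ler_wpM2l.
Unshelve. all: by end_near. Qed.

(** * Differentials as Jacobian matrices and gradients *)

Lemma diff_cVE (R : realType) (n : nat) (W : normedModType R)
  (F : 'cV[R]_n -> W) (u v : 'cV[R]_n) : differentiable F u ->
  'd F u v = \sum_j v j 0 *: 'd F u (delta_mx j 0).
Proof.
move=> dF; have {1}-> : v = \sum_j v j 0 *: delta_mx j 0.
  by rewrite {1}[v]matrix_sum_delta; apply: eq_bigr => j _; rewrite big_ord1.
by rewrite linear_sum; apply: eq_bigr => j _; rewrite linearZ.
Qed.

Lemma diff_jac (R : realType) (m n : nat) (F : 'cV[R]_n -> 'cV[R]_m)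
  (u v : 'cV[R]_n) : differentiable F u -> 'd F u v = jac F u *m v.
Proof.
move=> dF; rewrite diff_cVE//; apply/colP => i.
rewrite summxE mxE; apply: eq_bigr => j _.
by rewrite !mxE mulrC.
Qed.

Lemma diff_grad (R : realType) (n : nat) (S : 'cV[R]_n -> R)
  (u v : 'cV[R]_n) : differentiable S u -> 'd S u v = dotc (grad S u) v.
Proof.
move=> dS; rewrite diff_cVE// /dotc mxE; apply: eq_bigr => j _.
by rewrite !mxE mulrC.
Qed.

Lemma is_diff_jac (R : realType) (m n : nat) (F : 'cV[R]_n -> 'cV[R]_m)
  (u : 'cV[R]_n) (J : 'M[R]_(m, n)) :
  is_diff u F (fun h => J *m h) -> jac F u = J.
Proof.
move=> dF; apply/matrixP => i j.
by rewrite mxE diff_val -colE mxE.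
Qed.

(** * Straight lines, and continuity along them *)

(** Running the segment backwards swaps its endpoints; this is the geometric half of (C3), the other
    half being the substitution in [mint_onem]. *)
Lemma lineC (R : realType) (V : lmodType R) (a b : V) (s : R) :
  a + s *: (b - a) = b + (1 - s) *: (a - b).
Proof. by rewrite scalerBl scale1r addrA subrKC -scalerN opprB. Qed.

Lemma is_diff_line (R : realType) (V : normedModType R) (a b : V) (s : R) :
  is_diff s (fun t : R => a + t *: b) (fun t => t *: b).
Proof.
have dab := is_diffD (is_diff_cst a s) (is_diff_scalel s b).
by apply: (is_diff_eq dab); exact: add0r.
Qed.

Lemma differentiable_line (R : realType) (V W : normedModType R) (F : V -> W)
  (a b : V) (s : R) : differentiable F (a + s *: b) ->
  differentiable (fun t : R => F (a + t *: b)) s.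
Proof.
move=> dF; have dl := is_diff_line a b s.
exact: (differentiable_comp (f := fun t : R => a + t *: b) (g := F)).
Qed.

Lemma derive1_line (R : realType) (V W : normedModType R) (F : V -> W)
  (a b : V) (s : R) : differentiable F (a + s *: b) ->
  derive1 (fun t : R => F (a + t *: b)) s = 'd F (a + s *: b) b.
Proof.
move=> dF; rewrite derive1E'; last exact: differentiable_line.
have dl := is_diff_line a b s.
rewrite (diff_comp (f := fun t : R => a + t *: b) (g := F))//=.
by rewrite diff_val scale1r.
Qed.

(* Two-sided also at the endpoints, unlike {within `[0, 1], continuous F}. *)
Definition continuous01 (R : realType) (m k : nat) (F : R -> 'M[R]_(m, k)) :=
  forall s, 0 <= s <= 1 -> {for s, continuous F}.

Lemma continuous01_coord (R : realType) (m k : nat) (F : R -> 'M[R]_(m, k)) i j :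
  continuous01 F -> {within `[0, 1], continuous (fun s => F s i j)}.
Proof.
move=> cF; apply: continuous_in_subspaceT => s; rewrite inE/= in_itv/= => s01.
exact: (cvg_comp _ _ (cF s s01) (@coord_continuous _ _ _ i j (F s))).
Qed.

Lemma continuous_integrable01 (R : realType) (g : R -> R) :
  {within `[0, 1], continuous g} ->
  (@lebesgue_measure R).-integrable `[0, 1] (EFin \o g).
Proof.
by move=> cg; apply: continuous_compact_integrable => //; exact: segment_compact.
Qed.

Lemma continuous01_integrable (R : realType) (m k : nat)
  (F : R -> 'M[R]_(m, k)) i j : continuous01 F ->
  (@lebesgue_measure R).-integrable `[0, 1] (EFin \o (fun s => F s i j)).
Proof. by move=> cF; apply: continuous_integrable01; exact: continuous01_coord. Qed.

Lemma continuous01_mulmx (R : realType) (m n p : nat) (F : R -> 'M[R]_(m, n))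
  (K : R -> 'M[R]_(n, p)) : continuous01 F -> continuous01 K ->
  continuous01 (fun s => F s *m K s).
Proof. by move=> cF cK s s01; exact: cvg_mulmx (cF s s01) (cK s s01). Qed.

Lemma continuous01_cst (R : realType) (m k : nat) (M : 'M[R]_(m, k)) :
  continuous01 (fun=> M).
Proof. by move=> s _; exact: cvg_cst. Qed.

(** * Integrals of matrix-valued functions over [0, 1] *)

Lemma eq_mint (R : realType) (m k : nat) (F K : R -> 'M[R]_(m, k)) :
  (forall s, 0 <= s <= 1 -> F s = K s) -> mint F = mint K.
Proof.
move=> FK; apply/matrixP => i j; rewrite !mxE; apply: eq_Rintegral => s.
by rewrite inE/= in_itv/= => s01; rewrite FK.
Qed.

Lemma mintD (R : realType) (m k : nat) (F K : R -> 'M[R]_(m, k)) :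
  continuous01 F -> continuous01 K ->
  mint (fun s => F s + K s) = mint F + mint K.
Proof.
move=> cF cK; apply/matrixP => i j; rewrite !mxE.
rewrite -RintegralD//; [|exact: continuous01_integrable..].
by apply: eq_Rintegral => s _; rewrite mxE.
Qed.

Lemma mintB (R : realType) (m k : nat) (F K : R -> 'M[R]_(m, k)) :
  continuous01 F -> continuous01 K ->
  mint (fun s => F s - K s) = mint F - mint K.
Proof.
move=> cF cK; apply/matrixP => i j; rewrite !mxE.
rewrite -RintegralB//; [|exact: continuous01_integrable..].
by apply: eq_Rintegral => s _; rewrite !mxE.
Qed.

(** Entries of a matrix product are such sums, so this is what lets a constant matrix factor leave
    [mint]. *)
Lemma Rintegral01_sum (R : realType) (I : Type) (r : seq I) (g : I -> R -> R) :
  (forall i, {within `[0, 1], continuous (g i)}) ->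
  Rintegral (@lebesgue_measure R) `[0, 1] (fun s => \sum_(i <- r) g i s) =
  \sum_(i <- r) Rintegral (@lebesgue_measure R) `[0, 1] (g i).
Proof.
move=> cg; elim: r => [|i r IHr].
  under eq_Rintegral do rewrite big_nil.
  by rewrite Rintegral_cst// mul0r big_nil.
under eq_Rintegral do rewrite big_cons.
rewrite RintegralD ?IHr ?big_cons//; apply: continuous_integrable01 => //.
by move=> x; apply: (@cvg_big _ _ +%R) => [|j _]; [exact: add_continuous|exact: cg].
Qed.

Lemma mint_mulmxr (R : realType) (m n p : nat) (F : R -> 'M[R]_(m, n))
  (M : 'M[R]_(n, p)) : continuous01 F ->
  mint (fun s => F s *m M) = mint F *m M.
Proof.
move=> cF; apply/matrixP => i j; rewrite !mxE.
under eq_Rintegral do rewrite mxE.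
rewrite Rintegral01_sum => [|k x].
  apply: eq_bigr => k _; rewrite mxE RintegralZr//.
  exact: continuous01_integrable.
by apply: cvgM; [exact: continuous01_coord|exact: cvg_cst].
Qed.

Lemma mint_mulmxl (R : realType) (m n p : nat) (F : R -> 'M[R]_(n, p))
  (M : 'M[R]_(m, n)) : continuous01 F ->
  mint (fun s => M *m F s) = M *m mint F.
Proof.
move=> cF; apply/matrixP => i j; rewrite !mxE.
under eq_Rintegral do rewrite mxE.
rewrite Rintegral01_sum => [|k x].
  apply: eq_bigr => k _; rewrite mxE RintegralZl//.
  exact: continuous01_integrable.
by apply: cvgM; [exact: cvg_cst|exact: continuous01_coord].
Qed.

Lemma mint_onem (R : realType) (m k : nat) (F : R -> 'M[R]_(m, k)) :
  continuous01 F -> mint (fun s => F (1 - s)) = mint F.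
Proof.
move=> cF; apply/matrixP => i j; rewrite !mxE.
rewrite [RHS]Rintegration_by_substitution_onem ?ler01 ?lexx//.
  by rewrite unstable.onem1.
exact: continuous01_coord.
Qed.

(** Fundamental theorem of calculus; differentiability at 0 and 1 supplies the one-sided limits of
    [F] that it requires at the endpoints. *)
Lemma Rintegral01_derive1 (R : realType) (F f : R -> R) :
  {within `[0, 1], continuous f} ->
  (forall s : R, 0 <= s <= 1 -> differentiable F s /\ derive1 F s = f s) ->
  Rintegral (@lebesgue_measure R) `[0, 1] f = F 1 - F 0.
Proof.
move=> cf dF; rewrite /Rintegral (@continuous_FTC2 _ f F)//.
- split.
  + move=> s; rewrite in_itv/= => /andP[s0 s1].
    by apply/derivable1_diffP; apply: (dF _ _).1; rewrite !ltW.
  + apply: cvg_at_right_filter; apply: differentiable_continuous.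
    by apply: (dF _ _).1; rewrite lexx ler01.
  + apply: cvg_at_left_filter; apply: differentiable_continuous.
    by apply: (dF _ _).1; rewrite lexx ler01.
- move=> s; rewrite in_itv/= => /andP[s0 s1].
  by apply: (dF _ _).2; rewrite !ltW.
Qed.

Lemma continuous01Z (R : realType) (m k : nat) (c : R -> R)
  (F : R -> 'M[R]_(m, k)) : continuous c -> continuous01 F ->
  continuous01 (fun s => c s *: F s).
Proof. by move=> cc cF s s01; apply: cvgZ; [exact: cc|exact: cF]. Qed.

Lemma continuous_onem (R : realType) : continuous (fun s : R => 1 - s).
Proof. by move=> s; apply: cvgB; [exact: cvg_cst|exact: cvg_id]. Qed.

(** [G] is continuous at points of [W] as a map on the whole space, so the composite is continuous
    from both sides even where the line may leave [W], at [s = 0] and [s = 1]. *)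
Lemma continuous01_line (R : realType) (m k p r : nat) (W : set 'M[R]_(m, k))
  (G : 'M[R]_(m, k) -> 'M[R]_(p, r)) (a b : 'M[R]_(m, k)) :
  (forall x, W x -> {for x, continuous G}) ->
  (forall s, 0 <= s <= 1 -> W (a + s *: b)) ->
  continuous01 (fun s => G (a + s *: b)).
Proof.
move=> cG Wab s s01.
apply: (@continuous_comp _ _ _ (fun t : R => a + t *: b) G); last exact/cG/Wab.
apply: differentiable_continuous.
exact: (@ex_diff _ _ _ _ _ _ _ (is_diff_line a b s)).
Qed.

Lemma Rintegral_onem (R : realType) :
  Rintegral (@lebesgue_measure R) `[0, 1] (fun s => 1 - s) = 2^-1.
Proof.
have dF (s : R) : is_derive s 1 (fun s : R => s - 2^-1 * s ^+ 2) (1 - s).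
  by apply: is_derive_eq; rewrite /GRing.scale/=; field.
rewrite (@Rintegral01_derive1 _ (fun s => s - 2^-1 * s ^+ 2)).
- by field.
- by apply: continuous_in_subspaceT => s _; exact: continuous_onem.
- move=> s _; split.
    by apply/derivable1_diffP; exact: (@ex_derive _ _ _ _ _ _ _ (dF s)).
  by rewrite derive1E (@derive_val _ _ _ _ _ _ _ (dF s)).
Qed.

Lemma mint_onemZ (R : realType) (m k : nat) (M : 'M[R]_(m, k)) :
  mint (fun s => (1 - s) *: M) = 2^-1 *: M.
Proof.
apply/matrixP => i j; rewrite !mxE -Rintegral_onem -RintegralZr//.
  by apply: eq_Rintegral => s _; rewrite mxE.
apply: continuous_integrable01.
by apply: continuous_in_subspaceT => s _; exact: continuous_onem.
Qed.

Lemma normr_Rintegral01_le (R : realType) (g : R -> R) (e : R) :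
  {within `[0, 1], continuous g} -> (forall s, 0 <= s <= 1 -> `|g s| <= e) ->
  `|Rintegral (@lebesgue_measure R) `[0, 1] g| <= e.
Proof.
move=> cg ge; have ig := continuous_integrable01 cg.
rewrite (le_trans (le_normr_Rintegral _ _))//.
have -> : e = Rintegral (@lebesgue_measure R) `[0, 1] (fun=> e).
  rewrite Rintegral_cst//= lebesgue_measure_itv/= lte_fin ltr01 oppr0 adde0.
  by rewrite mulr1.
apply: le_Rintegral => //.
- by apply: continuous_integrable01 => s; apply: cvg_norm; exact: cg.
- by apply: continuous_integrable01 => s; exact: cvg_cst.
Qed.

Lemma mx_norm_mint_le (R : realType) (m k : nat) (F : R -> 'M[R]_(m, k))
  (e : R) : continuous01 F -> (forall s, 0 <= s <= 1 -> `|F s| <= e) ->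
  `|mint F| <= e.
Proof.
move=> cF Fe; apply: mx_norm_le => [|i j].
  by apply: le_trans (Fe 0 _); rewrite ?normr_ge0// lexx ler01.
rewrite mxE; apply: normr_Rintegral01_le => [|s s01].
  exact: continuous01_coord.
exact: le_trans (ler_mx_norm_coord _ _ _) (Fe s s01).
Qed.

(** The limit is itself the integral of [(1 - s) *: G x], so the difference is a single integral.
    Once [|d t| < k], the whole segment lies in the ball where [G] is [e]-close to [G x], uniformly
    in [s], and the weight [1 - s] is at most 1. *)
Lemma cvg_mint_line (R : realType) (n p r : nat) (W : set 'cV[R]_n)
  (G : 'cV[R]_n -> 'M[R]_(p, r)) (T : Type) (FF : set_system T)
  {FFF : Filter FF} (x : 'cV[R]_n) (d : T -> 'cV[R]_n) :
  W x -> (forall y, W y -> {for y, continuous G}) ->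
  (\forall t \near FF, forall s, 0 <= s <= 1 -> W (x + s *: d t)) ->
  d @ FF --> (0 : 'cV[R]_n) ->
  mint (fun s => (1 - s) *: G (x + s *: d t)) @[t --> FF] --> 2^-1 *: G x.
Proof.
move=> Wx cG Wd d0; rewrite -mint_onemZ; apply/cvgrPdist_le => e e0.
have /cvgrPdist_le/(_ e e0)/= /nbhs_ballP[k /= k0 kP] := cG x Wx.
have nd : \forall t \near FF, `|d t| < k.
  move/cvgrPdist_lt : d0 => /(_ k k0).
  by apply: filterS => t; rewrite sub0r normrN.
near=> t.
have Wt : forall s, 0 <= s <= 1 -> W (x + s *: d t) by near: t.
have dt : `|d t| < k by near: t.
have c1 := continuous01Z (@continuous_onem R) (continuous01_cst (M := G x)).
have c2 := continuous01Z (@continuous_onem R) (continuous01_line cG Wt).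
rewrite -(mintB c1 c2); apply: mx_norm_mint_le => [s s01|s /andP[s0 s1]].
  by apply: cvgB; [exact: c1|exact: c2].
rewrite -scalerBr normrZ ger0_norm ?subr_ge0//.
rewrite -[leRHS]mul1r ler_pM ?subr_ge0 ?lerBlDr ?lerDl//.
apply: kP; rewrite -ball_normE/= opprD addNKr normrN normrZ ger0_norm//.
by rewrite (le_lt_trans _ dt)// ler_piMl.
Unshelve. all: by end_near. Qed.

(** * The Jacobian of an inverse map, and the entropy balance as one integral *)

(** Chain rule, tested on each basis vector: near [u] the composite is the identity, and a
    derivative depends only on values near the point. *)
Lemma jac_inverse (R : realType) (n : nat) (f g : 'cV[R]_n -> 'cV[R]_n)
  (u : 'cV[R]_n) : differentiable f u -> differentiable g (f u) ->
  (\forall y \near u, g (f y) = y) -> jac g (f u) *m jac f u = 1%:M.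
Proof.
move=> df dg gf; apply/matrixP => i j.
have -> : (jac g (f u) *m jac f u) i j =
    (jac g (f u) *m (jac f u *m (delta_mx j 0 : 'cV_n))) i 0.
  by rewrite mulmxA -colE [RHS]mxE.
rewrite -!diff_jac//.
have /= <- := congr1 (@^~ (delta_mx j 0)) (diff_comp df dg).
rewrite -deriveE; last exact: differentiable_comp.
by rewrite (@near_eq_derive _ _ _ (g \o f) id)// derive_id !mxE eqxx andbT.
Qed.

Lemma continuous_trmx (R : realType) (m n : nat) :
  continuous (fun M : 'M[R]_(m, n) => M^T).
Proof.
move=> M; apply: (cvg_mx_coord (G := nbhs M)) => i j; rewrite mxE.
by under eq_fun do rewrite mxE; exact: coord_continuous.
Qed.

Lemma continuous01_line_mulmx (R : realType) (n p : nat)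
  (K : R -> 'M[R]_(n, p)) (a b : 'cV[R]_n) (v : 'cV[R]_p) : continuous01 K ->
  continuous01 (fun s => (a + s *: b)^T *m (K s *m v)).
Proof.
move=> cK; apply: continuous01_mulmx; last first.
  exact: continuous01_mulmx cK (continuous01_cst (M := v)).
have ct (x : 'cV[R]_n) : setT x -> {for x, continuous (fun M => M^T)}.
  by move=> _; exact: continuous_trmx.
by move=> s s01; exact: (continuous01_line ct).
Qed.

(** The weights combine as [(1 - s) a + s b = a + s (b - a)]. With [a], [b] the entropy variables of
    the two states, the left side is that of (C4). *)
Lemma dotc_mint_line (R : realType) (n p : nat) (K : R -> 'M[R]_(n, p))
  (a b : 'cV[R]_n) (v : 'cV[R]_p) : continuous01 K ->
  dotc a (mint (fun s => (1 - s) *: K s) *m v) +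
    dotc b (mint (fun s => s *: K s) *m v) =
  mint (fun s => (a + s *: (b - a))^T *m (K s *m v)) 0 0.
Proof.
move=> cK.
have c0 : continuous01 (fun s => (1 - s) *: K s *m v).
  apply: continuous01_mulmx; last exact: continuous01_cst.
  exact: continuous01Z (@continuous_onem R) cK.
have c1 : continuous01 (fun s => s *: K s *m v).
  apply: continuous01_mulmx; last exact: continuous01_cst.
  by apply: continuous01Z => // s; exact: cvg_id.
have mxD00 (X Y : 'M[R]_1) : X 0 0 + Y 0 0 = (X + Y) 0 0 by rewrite mxE.
rewrite /dotc -!mint_mulmxr; last 2 first.
- by apply: continuous01Z => // s; exact: cvg_id.
- exact: continuous01Z (@continuous_onem R) cK.
rewrite -(mint_mulmxl _ c0) -(mint_mulmxl _ c1) mxD00 -mintD; last 2 first.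
- by apply: continuous01_mulmx c0; exact: continuous01_cst.
- by apply: continuous01_mulmx c1; exact: continuous01_cst.
congr (fun_of_matrix _ 0 0); apply: eq_mint => s _.
rewrite linearD linearZ linearB /= mulmxDl -!scalemxAl mulmxBl -!scalemxAr.
by rewrite scalerBl scale1r scalerBr addrA addrAC.
Qed.

(** * Verification of (C1) to (C5) *)

Unset Implicit Arguments.

Theorem theorem2 (R : realType) (n : nat) (U : set 'cV[R]_n)
  (f : 'cV[R]_n -> 'cV[R]_n) (B : 'cV[R]_n -> 'M[R]_n)
  (S q : 'cV[R]_n -> R) (ui : 'cV[R]_n -> 'cV[R]_n) :
  open U ->
  (* flux f is differentiable; A := f_u + B *)
  (forall u, U u -> differentiable f u) ->
  (* S strictly convex and C^2; w := grad S are the entropy variables *)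
  strictly_convex_on U S ->
  C2_on U S ->
  (* entropy flux: q_u = w^T A *)
  (forall u, U u -> differentiable q u /\ grad q u = (genA f B u)^T *m grad S u) ->
  (* u |-> w(u) is a C^1 diffeomorphism of U onto the convex set W = w(U),
     with inverse ui *)
  convex_setR (grad S @` U) ->
  (forall u, U u -> ui (grad S u) = u) ->
  C1_on (grad S @` U) ui ->
  (* A and H := jac ui are continuous *)
  (forall u, U u -> {for u, continuous (genA f B)}) ->
  (forall x, (grad S @` U) x -> {for x, continuous (jac ui)}) ->
  EC_fluctuations U (genA f B) (grad S) q
    (fun uL uR s => ui (grad S uL + s *: (grad S uR - grad S uL)))
    (Dminus (genA f B) (grad S) ui) (Dplus (genA f B) (grad S) ui).
Proof.
move=> oU _ _ [_ [dw _]] dq cvxW wK [dui _] cA cH.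
move: (genA f B) (grad S) => A w in dw dq cvxW wK dui cA cH *.
set W := w @` U in cvxW dui cH.
pose G x := A (ui x) *m jac ui x.
have Ww u : U u -> W (w u) by move=> Uu; exists u.
have cG x : W x -> {for x, continuous G}.
  move=> Wx; apply: (cvg_mulmx (G := nbhs x)); last exact: cH.
  apply: (@continuous_comp _ _ _ ui A); first exact/differentiable_continuous/dui.
  by case: Wx => u Uu <-; rewrite wK//; exact: cA.
have Wseg uL uR s : U uL -> U uR -> 0 <= s <= 1 -> W (w uL + s *: (w uR - w uL)).
  move=> UL UR s01; have := cvxW _ _ s (Ww _ UL) (Ww _ UR) s01.
  by rewrite scalerBl scale1r scalerBr addrA addrAC.
have cGs uL uR : U uL -> U uR ->
    continuous01 (fun s => G (w uL + s *: (w uR - w uL))).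
  by move=> UL UR; apply: (continuous01_line (W := W)) => // s; exact: Wseg.
have DmE uL uR : Dminus A w ui uL uR =
    mint (fun s => (1 - s) *: G (w uL + s *: (w uR - w uL))) *m (w uR - w uL) by [].
have DpE uL uR : Dplus A w ui uL uR =
    mint (fun s => s *: G (w uL + s *: (w uR - w uL))) *m (w uR - w uL) by [].
have cGm uL uR : U uL -> U uR -> continuous01
    (fun s => (1 - s) *: G (w uL + s *: (w uR - w uL))).
  by move=> UL UR; apply: continuous01Z; [exact: continuous_onem|exact: cGs].
have cGp uL uR : U uL -> U uR -> continuous01
    (fun s => s *: G (w uL + s *: (w uR - w uL))).
  by move=> UL UR; apply: continuous01Z; [by move=> s; exact: cvg_id|exact: cGs].
split.
- by move=> u Uu; rewrite DmE DpE subrr !mulmx0.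
- move=> uL uR UL UR; rewrite DmE DpE -mulmxDl -mintD; [|exact: cGm|exact: cGp].
  rewrite -mint_mulmxr; last first.
    by move=> s s01; apply: cvgD; [exact: cGm|exact: cGp].
  (* The weights add up to 1; what remains is [A] times the derivative of the path, by the chain
     rule. *)
  apply: eq_mint => s s01; rewrite -scalerDl subrK scale1r.
  have dPhi := dui _ (Wseg _ _ _ UL UR s01).
  by rewrite derive1_line// diff_jac// mulmxA.
- move=> uL uR UL UR; rewrite DmE DpE.
  have XYab (X Y : 'M[R]_n) (a b : 'cV[R]_n) :
      X = Y -> X *m (a - b) + Y *m (b - a) = 0.
    by move=> ->; rewrite -mulmxDr addrA subrK subrr mulmx0.
  apply: XYab.
  (* Substituting [1 - s] turns the weight [s] of [Dplus] into [1 - s], and the reversed segment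
     from [w uR] is the one from [w uL]; the opposite jumps then cancel. *)
  rewrite -[RHS](mint_onem (cGp _ _ UR UL)); apply: eq_mint => s _.
  by rewrite (lineC (w uL)).
- move=> uL uR UL UR; rewrite DmE DpE dotc_mint_line; last exact: cGs.
  rewrite mxE (@Rintegral01_derive1 _
    (fun s => (q \o ui) (w uL + s *: (w uR - w uL)))).
  + by rewrite /= scale0r scale1r addr0 subrKC !wK.
  + by apply: continuous01_coord; apply: continuous01_line_mulmx; exact: cGs.
  + move=> s s01; have Ws := Wseg _ _ _ UL UR s01.
    have [dqu qE] : differentiable q (ui (w uL + s *: (w uR - w uL))) /\
      grad q (ui (w uL + s *: (w uR - w uL))) =
        (A (ui (w uL + s *: (w uR - w uL))))^T *m (w uL + s *: (w uR - w uL)).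
      (* A point of the segment is [w u] for some [u] in [U], so the entropy variable at [ui] of
         that point is the point itself. *)
      by case: Ws => u Uu <-; rewrite wK//; exact: dq.
    have dqui : differentiable (q \o ui) (w uL + s *: (w uR - w uL)).
      by apply: differentiable_comp => //; exact: dui.
    split; first exact: differentiable_line.
    rewrite derive1_line// diff_comp//; last exact: dui.
    rewrite /= diff_grad// diff_jac; last exact: dui.
    by rewrite qE /dotc trmx_mul trmxK /G !mulmxA.
- move=> uL UL.
  have dwL := dw _ UL.
  have dwB : is_diff uL (fun u => w u - w uL) ('d w uL).
    have dwc := is_diffB (differentiableP dwL) (is_diff_cst (w uL) uL).
    by apply: (is_diff_eq dwc); exact: subr0.
  pose M u := mint (fun s => (1 - s) *: G (w uL + s *: (w u - w uL))).
  (* At [u = uL] the segment degenerates to a point, and the integral of [1 - s] is 1/2. *)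
  have ML : M uL = 2^-1 *: G (w uL).
    by rewrite -mint_onemZ; apply: eq_mint => s _; rewrite subrr scaler0 addr0.
  have cM : {for uL, continuous M}.
    rewrite /prop_for /continuous_at ML.
    apply: (cvg_mint_line (W := W) (FF := nbhs uL)) => //; first exact: Ww.
    (* Since [U] is open, every [u] near [uL] lies in [U], and convexity of [W] keeps its segment in
       [W]. *)
    + have : \forall u \near uL, U u by exact: open_nbhs_nbhs.
      by apply: filterS => u Uu s; exact: Wseg.
    + rewrite -(subrr (w uL)); apply: cvgB; last exact: cvg_cst.
      exact: differentiable_continuous.
  have := @is_diff_mulmx0 _ _ _ _ _ M (fun u => w u - w uL) uL cM.
  rewrite subrr => /(_ (@ex_diff _ _ _ _ _ _ _ dwB) erefl) dDm.
  have JA : is_diff uL (Dminus A w ui uL) (fun h => (2^-1 *: A uL) *m h).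
    apply: (is_diff_eq dDm); apply/funext => h.
    rewrite diff_val ML diff_jac// /G wK// -!scalemxAl -!mulmxA.
    (* [ui] inverts [w] on a neighbourhood of [uL], so the two Jacobians cancel and only half of
       [A uL] is left. *)
    rewrite (mulmxA (jac ui _)) jac_inverse ?mul1mx//; first exact/dui/Ww.
    have : \forall u \near uL, U u by exact: open_nbhs_nbhs.
    by apply: filterS => u; exact: wK.
  by split; [exact: (@ex_diff _ _ _ _ _ _ _ JA)|exact: is_diff_jac].
Qed.
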